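(* Let $1\le m\le n$ be integers and let $A\in\mathbb{R}^{n\times n}$ be arbitrary. The following algorithm converges locally quadratically to the orthogonal projector $P^{*}\in\mathrm{Gr}_{m,n}$ onto any $m$-dimensional stable invariant subspace of $A$. Algorithm. Pick $\Theta_0\in \mathrm{SO}_n$ and put $P_0=\Theta_0^{\top}\begin{bmatrix}I_m&0\\0&0\end{bmatrix}\Theta_0$. For $j=0,1,2,\dots$: (i) compute the blocks $\begin{bmatrix}A_{11}&A_{12}\\ A_{21}&A_{22}\end{bmatrix}=\Theta_jA\Theta_j^{\top}$ with $A_{11}\in\mathbb{R}^{m\times m}$; (ii) solve the linear matrix equation $$\begin{aligned}&A_{11}(A_{11}^{\top}Z_j-Z_jA_{22}^{\top})-(A_{11}^{\top}Z_j-Z_jA_{22}^{\top})A_{22}\\&-A_{21}^{\top}(Z_j^{\top}A_{12}+A_{21}Z_j)-(A_{12}Z_j^{\top}+Z_jA_{21})A_{21}^{\top}=A_{21}^{\top}A_{22}-A_{11}A_{21}^{\top}\end{aligned}$$ for $Z_j\in\mathbb{R}^{m\times(n-m)}$; (iii) set $\Theta_{j+1}^{\top}=\Theta_j^{\top}\begin{bmatrix}I_m&Z_j\\-Z_j^{\top}&I_{n-m}\end{bmatrix}_{Q}$ and $P_{j+1}=\Theta_{j+1}^{\top}\begin{bmatrix}I_m&0\\0&0\end{bmatrix}\Theta_{j+1}$.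
   Context: $\mathrm{Gr}_{m,n}=\{P\in\mathbb{R}^{n\times n}: P^{\top}=P,\ P^2=P,\ \operatorname{tr}P=m\}$. $\mathrm{SO}_n$ is the group of real orthogonal $n\times n$ matrices of determinant $1$. For an invertible real matrix $M$, $M_Q$ denotes the orthogonal factor in the unique factorization $M=M_QM_R$ with $M_Q$ orthogonal and $M_R$ upper triangular with positive diagonal. An invariant subspace $V$ of a linear operator $A:X\to X$ is called stable if the restriction $A|_V$ and the induced (corestriction) operator on $X/V$ have disjoint (complex) spectra. ''The algorithm converges locally quadratically to $P^{*}$'' means: there are a neighborhood $V\subset\mathrm{Gr}_{m,n}$ of $P^{*}$ and a constant $C$ such that, for every $\Theta_0\in\mathrm{SO}_n$ with $P_0\in V$, all steps are well defined (the linear matrix equations are uniquely solvable), $P_j\to P^{*}$, and $\|P_{j+1}-P^{*}\|\le C\|P_j-P^{*}\|^2$ for all $j$. *)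

(* Defs.v *)
From HB Require Import structures.
From mathcomp Require Export all_boot all_order all_algebra.
From mathcomp Require Export complex.
From mathcomp Require Export all_classical all_reals all_analysis.
Export Order.TTheory GRing.Theory Num.Theory.
Export numFieldNormedType.Exports.

#[export] Set Implicit Arguments.
#[export] Unset Strict Implicit.
#[export] Unset Printing Implicit Defensive.

Open Scope classical_set_scope.
Open Scope ring_scope.

Section Matrices.
Variables (R : realType) (n : nat).

Definition orthogonal_mx : set 'M[R]_n := [set Q | Q^T *m Q = 1%:M].

Definition SO : set 'M[R]_n := [set Q | orthogonal_mx Q /\ \det Q = 1].

Definition Gr (m : nat) : set 'M[R]_n :=
  [set P | [/\ P^T = P, P *m P = P & \tr P = m%:R]].

Definition upper_pos : set 'M[R]_n :=
  [set U | (forall i j : 'I_n, (j < i)%N -> U i j = 0) /\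
           (forall i : 'I_n, 0 < U i i)].

(* The orthogonal factor M_Q of M = M_Q M_R. It exists and is unique when M is
   invertible; otherwise the value is irrelevant. *)
Definition qr_Q (M : 'M[R]_n) : 'M[R]_n :=
  xget 1%:M [set Q | orthogonal_mx Q /\ exists2 U, upper_pos U & M = Q *m U].

End Matrices.

Section Stable.
Variables (R : realType) (n : nat).
Implicit Types (A : 'M[R]_n) (V : {vspace 'cV[R]_n}).

(* A acts on column vectors by x |-> A x. *)
Definition invariant_subspace A V : Prop :=
  forall x, x \in V -> A *m x \in V.

(* Membership in the complexification V + iV of V, inside C^n. *)
Definition in_complexification V (z : 'cV[R[i]]_n) : bool :=
  (map_mx (@complex.Re R) z \in V) && (map_mx (@complex.Im R) z \in V).

Definition complexify A : 'M[R[i]]_n := map_mx (real_complex R) A.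

(* Complex spectra of A|_V and of the operator induced by A on R^n / V, for V
   invariant. An eigenvector of the latter is a nonzero class z + V_C in
   C^n / V_C, i.e. z is not in V_C, with A z = lambda z modulo V_C. *)
Definition spectrum_restriction A V : set R[i] :=
  [set lambda | exists z : 'cV[R[i]]_n,
     [/\ in_complexification V z, z != 0 & complexify A *m z = lambda *: z]].

Definition spectrum_quotient A V : set R[i] :=
  [set lambda | exists z : 'cV[R[i]]_n,
     ~~ in_complexification V z /\
     in_complexification V (complexify A *m z - lambda *: z)].

Definition stable_invariant_subspace A V : Prop :=
  invariant_subspace A V /\
  spectrum_restriction A V `&` spectrum_quotient A V = set0.

Definition orthogonal_projector_onto V (P : 'M[R]_n) : Prop :=
  [/\ P^T = P, P *m P = P & forall x, x \in V <-> exists y, x = P *m y].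

End Stable.

(* The ambient dimension is n = m + k, so that k = n - m. *)
Section Algorithm.
Variables (R : realType) (m k : nat).
Implicit Types (A Theta : 'M[R]_(m + k)) (Z : 'M[R]_(m, k)).

Definition proj_of Theta : 'M[R]_(m + k) :=
  Theta^T *m block_mx 1%:M 0 0 0 *m Theta.

Definition newton_eq A Theta Z : Prop :=
  let B := Theta *m A *m Theta^T in
  let A11 := ulsubmx B in
  let A12 := ursubmx B in
  let A21 := dlsubmx B in
  let A22 := drsubmx B in
  A11 *m (A11^T *m Z - Z *m A22^T) - (A11^T *m Z - Z *m A22^T) *m A22
  - A21^T *m (Z^T *m A12 + A21 *m Z) - (A12 *m Z^T + Z *m A21) *m A21^T
  = A21^T *m A22 - A11 *m A21^T.

Definition newton_Z A Theta : 'M[R]_(m, k) := xget 0 [set Z | newton_eq A Theta Z].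

Definition retraction_mx Z : 'M[R]_(m + k) := block_mx 1%:M Z (- Z^T) 1%:M.

Definition step A Theta : 'M[R]_(m + k) :=
  (Theta^T *m qr_Q (retraction_mx (newton_Z A Theta)))^T.

Definition step_well_defined A Theta : Prop :=
  (exists! Z, newton_eq A Theta Z) /\
  retraction_mx (newton_Z A Theta) \in unitmx.

Definition Theta_seq A Theta0 (j : nat) : 'M[R]_(m + k) := iter j (step A) Theta0.

Definition P_seq A Theta0 (j : nat) : 'M[R]_(m + k) :=
  proj_of (Theta_seq A Theta0 j).

(* [within (Gr m) (nbhs Pstar)] is the neighborhood filter of Pstar in the
   subspace Gr m; the norm is the entrywise maximum norm. *)
Definition converges_locally_quadratically A (Pstar : 'M[R]_(m + k)) : Prop :=
  exists (V : set 'M[R]_(m + k)) (C : R),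
    [/\ V `<=` @Gr R (m + k) m,
        within (@Gr R (m + k) m) (nbhs Pstar) V &
        forall Theta0, @SO R (m + k) Theta0 -> V (proj_of Theta0) ->
          [/\ forall j, step_well_defined A (Theta_seq A Theta0 j),
              P_seq A Theta0 j @[j --> \oo] --> Pstar &
              forall j, `|P_seq A Theta0 j.+1 - Pstar|
                          <= C * `|P_seq A Theta0 j - Pstar| ^+ 2]].

End Algorithm.

(* Main.v *)
Require Import Defs.
From HB Require Import structures.
From mathcomp Require Import ring lra.

(**
Newton's equation is read in the original coordinates, as an equation for
X = P X (1 - P), with P the current projector.  Up to terms of size |(1-P)AP|, its
left-hand side is the composite of two Sylvester operators, both injective at P* because
the spectra of A on V and on the quotient are disjoint; extended by the identity it
therefore stays uniformly invertible for P near P*.  Put D = P - P*.  The off-diagonal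
part P D (1-P) solves Newton's equation up to O(|D|^2), hence differs from X by
O(|D|^2).  Finally, the R-factor of the retraction matrix is block diagonal, so the new
projector is G P G^-1 with G = 1 + X - X^T, that is P - X - X^T + O(|D|^2), while
P* = P - P D (1-P) - (1-P) D P + O(|D|^2).
*)

(** * Sylvester operators and disjoint spectra *)

Section Sylvester.

(* Under the dichotomy, left or right multiplication by [M - lambda%:M] is injective on
   such [Y], and by Cayley-Hamilton a product of these operators vanishes. *)
Lemma commuting_offdiag_eq0 (F : closedFieldType) n (M E Y : 'M[F]_n) :
  E *m M = M *m E ->
  (forall lambda, (M - lambda%:M) *m E + (1%:M - E) \in unitmx
               \/ (M - lambda%:M) *m (1%:M - E) + E \in unitmx) ->
  E *m Y = Y -> Y *m E = 0 -> M *m Y = Y *m M -> Y = 0.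
Proof.
case: n M E Y => [|n] M E Y EM dich EY YE MY; first by rewrite [Y]flatmx0.
have [s Ds] := closed_field_poly_normal (char_poly M).
have : horner_mx M (char_poly M) *m Y = 0 by rewrite Cayley_Hamilton mul0mx.
rewrite Ds (monicP (char_poly_monic M)) scale1r rmorph_prod /=.
elim: s {Ds} => [|a s IH]; first by rewrite big_nil mul1mx.
rewrite big_cons /= rmorphB /= horner_mx_X horner_mx_C -mulmxA.
set W := (\prod_(i <- s) _) *m Y => NW; apply: IH; rewrite -/W.
have EW : E *m W = W.
  rewrite /W; elim: (s) => [|b t IH]; first by rewrite big_nil mul1mx.
  rewrite big_cons /= rmorphB /= horner_mx_X horner_mx_C -mulmxA -{2}IH !mulmxA.
  by congr (_ *m _ *m _); rewrite mulmxBl mulmxBr EM scalar_mxC.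
have MW : M *m W = W *m M.
  rewrite /W; elim: (s) => [|b t IH]; first by rewrite big_nil mul1mx.
  rewrite -mulmxA in IH.
  rewrite big_cons /= rmorphB /= horner_mx_X horner_mx_C -!mulmxA -IH mulmxA.
  by rewrite [RHS]mulmxA; congr (_ *m _); rewrite mulmxBl mulmxBr scalar_mxC.
have WE : W *m E = 0 by rewrite /W -mulmxA YE mulmx0.
case: (dich a) => u.
  rewrite -[W](mulKmx u) [X in _ *m X](_ : _ = 0) ?mulmx0 //.
  by rewrite mulmxDl -mulmxA EW NW mulmxBl mul1mx EW subrr addr0.
rewrite -[W](mulmxK u) [X in X *m _](_ : _ = 0) ?mul0mx //.
have WN : W *m (M - a%:M) = 0 by rewrite mulmxBr -MW scalar_mxC -mulmxBl.
by rewrite [LHS]mulmxDr WE mulmxA WN mul0mx addr0.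
Qed.

Lemma nonunit_kernel (F : fieldType) n (M : 'M[F]_n) :
  M \notin unitmx -> exists2 z : 'cV[F]_n, z != 0 & M *m z = 0.
Proof.
rewrite -unitmx_tr -row_free_unit -kermx_eq0 => /rowV0Pn[v].
move/sub_kermxP => vM v0; exists v^T; first by rewrite -trmx0 (inj_eq trmx_inj).
by rewrite -[LHS]trmxK trmx_mul trmxK vM trmx0.
Qed.

Variables (R : realType) (n : nat).
Implicit Types (A P : 'M[R]_n) (V : {vspace 'cV[R]_n}).

Lemma map_Re_complexify A (z : 'cV[R[i]]_n) :
  map_mx (@complex.Re R) (complexify A *m z) = A *m map_mx (@complex.Re R) z.
Proof.
apply/matrixP => i j; rewrite !mxE [LHS]raddf_sum.
by apply: eq_bigr => l _; rewrite !mxE; case: (z l j) => a b /=; rewrite mul0r subr0.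
Qed.

Lemma map_Im_complexify A (z : 'cV[R[i]]_n) :
  map_mx (@complex.Im R) (complexify A *m z) = A *m map_mx (@complex.Im R) z.
Proof.
apply/matrixP => i j; rewrite !mxE [LHS]raddf_sum.
by apply: eq_bigr => l _; rewrite !mxE; case: (z l j) => a b /=; rewrite mul0r addr0.
Qed.

(** Real and imaginary parts are tested separately: [P] fixes exactly the vectors of [V]. Membership
    in the complexification thus becomes a matrix equation. *)
Lemma in_complexificationP V P (z : 'cV[R[i]]_n) :
  orthogonal_projector_onto V P ->
  reflect (complexify P *m z = z) (in_complexification V z).
Proof.
case=> _ PP VP; apply: (iffP andP) => [[/VP[x Dx] /VP[y Dy]]|Dz].
  have eqRI (u v : 'cV[R[i]]_n) : map_mx (@complex.Re R) u = map_mx (@complex.Re R) v ->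
      map_mx (@complex.Im R) u = map_mx (@complex.Im R) v -> u = v.
    move=> /matrixP e1 /matrixP e2; apply/matrixP => i j.
    move: (e1 i j) (e2 i j); rewrite !mxE.
    by case: (u i j) => a b; case: (v i j) => c d /= -> ->.
  by apply: eqRI; rewrite ?map_Re_complexify ?map_Im_complexify ?Dx ?Dy mulmxA PP.
split; apply/VP; rewrite -Dz.
  by rewrite map_Re_complexify; eexists.
by rewrite map_Im_complexify; eexists.
Qed.

Lemma invariant_subspace_projector A V P :
  invariant_subspace A V -> orthogonal_projector_onto V P ->
  P *m A *m P = A *m P.
Proof.
move=> invA [PT PP VP];
have key (x : 'cV[R]_n) : P *m (A *m (P *m x)) = A *m (P *m x).
  have /VP[y ->] : A *m (P *m x) \in V by apply/invA/VP; exists x.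
  by rewrite mulmxA PP.
apply/matrixP => i j.
have /matrixP/(_ i 0) := key (delta_mx j 0).
by rewrite !mulmxA -!colE !mxE.
Qed.

(** If both matrices were singular, a kernel vector of the first would be an eigenvector of [A] in
    the complexification of [V], and one of the second would represent an eigenvector on the
    quotient. Then [lambda] would lie in both spectra. *)
Lemma stable_blockdiag_dichotomy A V P (Ad := P *m A *m P + (1%:M - P) *m A *m (1%:M - P)) :
  stable_invariant_subspace A V -> orthogonal_projector_onto V P ->
  forall lambda : R[i],
    (complexify Ad - lambda%:M) *m complexify P + (1%:M - complexify P) \in unitmx
    \/ (complexify Ad - lambda%:M) *m (1%:M - complexify P) + complexify P \in unitmx.
Proof.
move=> [invA disj] hP lambda; have PAP := invariant_subspace_projector invA hP.
have [PT PP VP] := hP.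
set p := complexify P; set a := complexify A.
have pp : p *m p = p by rewrite -map_mxM PP.
have pap : p *m a *m p = a *m p by rewrite -!map_mxM PAP.
have pq : p *m (1%:M - p) = 0 by rewrite mulmxBr mulmx1 pp subrr.
have qp : (1%:M - p) *m p = 0 by rewrite mulmxBl mul1mx pp subrr.
have qq : (1%:M - p) *m (1%:M - p) = 1%:M - p by rewrite mulmxBr mulmx1 qp subr0.
have DAd : complexify Ad = a *m p + (1%:M - p) *m a *m (1%:M - p).
  by rewrite /complexify map_mxD !map_mxM map_mxB map_mx1 -/p -/a pap.
have [|N1] := boolP ((complexify Ad - lambda%:M) *m p + (1%:M - p) \in unitmx); first by left.
have [|N2] := boolP ((complexify Ad - lambda%:M) *m (1%:M - p) + p \in unitmx); first by right.
have [z1 z10 e1] := nonunit_kernel N1; have [z2 z20 e2] := nonunit_kernel N2.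
have Adp : (complexify Ad - lambda%:M) *m p = a *m p - lambda *: p.
  by rewrite mulmxBl DAd (mulmxDl (a *m p)) -!mulmxA qp !mulmx0 addr0 pp mul_scalar_mx.
have Adq : (complexify Ad - lambda%:M) *m (1%:M - p) =
    (1%:M - p) *m a *m (1%:M - p) - lambda *: (1%:M - p).
  by rewrite mulmxBl DAd (mulmxDl (a *m p)) -!mulmxA pq qq mulmx0 add0r mul_scalar_mx.
(* Multiplying the kernel equations by [1 - p] and by [p] puts [z1] in the image of [p] and [z2] in
   its kernel. *)
have pz1 : p *m z1 = z1.
  have := congr1 (mulmx (1%:M - p)) e1.
  rewrite Adp mulmxA mulmxDr mulmxBr -scalemxAr -pap !mulmxA qp !mul0mx scaler0 subrr.
  rewrite add0r qq mulmx0.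
  by rewrite mulmxBl mul1mx => /eqP; rewrite subr_eq0 => /eqP.
have pz2 : p *m z2 = 0.
  have := congr1 (mulmx p) e2.
  by rewrite Adq mulmxA mulmxDr mulmxBr -scalemxAr !mulmxA pq !mul0mx scaler0 subrr add0r pp mulmx0.
have: (spectrum_restriction A V `&` spectrum_quotient A V) lambda.
  split.
    exists z1; split => //; first exact/(in_complexificationP _ hP).
    move: e1; rewrite Adp mulmxDl !mulmxBl mul1mx -scalemxAl -mulmxA pz1 subrr addr0.
    by move=> /eqP; rewrite subr_eq0 => /eqP.
  exists z2; split.
    apply/negP => /(in_complexificationP _ hP); rewrite -/p pz2 => z0.
    by rewrite -z0 eqxx in z20.
  apply/(in_complexificationP _ hP); rewrite -/p -/a.
  have qz2 : (1%:M - p) *m z2 = z2 by rewrite mulmxBl mul1mx pz2 subr0.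
  suff -> : a *m z2 - lambda *: z2 = p *m (a *m z2) by rewrite mulmxA pp.
  move: e2; rewrite Adq (mulmxDl _ p) pz2 addr0 (mulmxBl (_ *m _)) -scalemxAl -2!mulmxA qz2.
  by rewrite mulmxBl mul1mx addrAC => /eqP; rewrite subr_eq0 => /eqP.
by rewrite disj.
Qed.

End Sylvester.

(** * QR factorization *)

Section QR.
Variable R : realType.

(** Induction on the size: split off the first row and column, with pivot [u = sqrt a], and factor
    the Schur complement [D - r^T r]. *)
Lemma cholesky n (S : 'M[R]_n) :
  S^T = S -> (forall x : 'cV[R]_n, x != 0 -> 0 < (x^T *m S *m x) 0 0) ->
  exists2 U, upper_pos U & U^T *m U = S.
Proof.
elim: n S => [|n IH]; last rewrite -[n.+1]/(1 + n)%N; move=> S ST Spos.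
  by exists 1%:M; [split; case | rewrite [LHS]flatmx0 [RHS]flatmx0].
move: ST Spos; rewrite -[S]submxK.
set a := ulsubmx S; set b := ursubmx S; set c := dlsubmx S; set D := drsubmx S.
rewrite tr_block_mx => /eq_block_mx[_ _ bc DT] Spos.
have a0 : 0 < a 0 0.
  have /Spos : col_mx (1%:M : 'cV[R]_1) (0 : 'cV[R]_n) != 0.
    by rewrite col_mx_eq0 negb_and oner_eq0.
  rewrite tr_col_mx mul_row_block mul_row_col trmx0 !mul0mx mulmx0 !addr0.
  by rewrite trmx1 mul1mx mulmx1.
pose u := Num.sqrt (a 0 0).
have u0 : 0 < u by rewrite sqrtr_gt0.
have uu : u * u = a 0 0 by rewrite -expr2 sqr_sqrtr // ltW.
have Da : a = (u * u)%:M by rewrite uu -mx11_scalar.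
pose r := u^-1 *: b.
have rT : r^T = u^-1 *: c by rewrite linearZ /= bc.
have [||U [Utri Upos] UU] := IH (D - r^T *m r).
- by rewrite raddfB /= DT trmx_mul trmxK.
- move=> x x0.
  (* The first coordinate [- b x / a] minimizes the quadratic form of [S] for given [x]; the minimum
     is the form of the Schur complement, hence positive. *)
  pose p := - (u * u)^-1; pose v := b *m x.
  have /Spos : col_mx (p *: v) x != 0 by rewrite col_mx_eq0 negb_and x0 orbT.
  rewrite tr_col_mx mul_row_block mul_row_col.
  congr (0 < _); congr (fun_of_matrix _ 0 0).
  have vT : v^T = x^T *m c by rewrite /v trmx_mul bc.
  have up : u * u * p = -1 by rewrite mulrN divff // mulf_neq0 ?gt_eqF.
  have pvT : (p *: v)^T = p *: v^T by rewrite linearZ.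
  rewrite Da mul_mx_scalar pvT scalerA up scaleN1r vT addNr mul0mx add0r.
  rewrite mulmxDl mulmxBr mulmxBl addrC; congr (_ + _).
  rewrite -scalemxAl -scalemxAl -!mulmxA -/v rT /r -scalemxAl -scalemxAl -!scalemxAr.
  by rewrite !scalerA -/v -scaleNr /p invfM.
exists (block_mx u%:M r 0 U).
  split=> [i j|i].
    rewrite -(splitK i) -(splitK j); case: (fintype.split i) => i'; case: (fintype.split j) => j' /=.
    - by rewrite !ord1.
    - by rewrite !ord1.
    - by rewrite block_mxEdl mxE.
    - by rewrite block_mxEdr => /=; rewrite ltn_add2l => /Utri.
  rewrite -(splitK i); case: (fintype.split i) => i' /=.
    by rewrite block_mxEul !ord1 mxE.
  by rewrite block_mxEdr.
rewrite tr_block_mx mulmx_block !trmx0 !mul0mx mulmx0 !addr0 tr_scalar_mx.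
rewrite -scalar_mxM -Da UU.
rewrite mul_scalar_mx mul_mx_scalar [r^T *m r + _]addrC subrK rT.
by rewrite /r !scalerA divff ?gt_eqF // !scale1r.
Qed.

Lemma mulTmx_eq0 n (x : 'cV[R]_n) : (x^T *m x) 0 0 = 0 -> x = 0.
Proof.
rewrite mxE => /eqP; rewrite psumr_eq0 => [/allP h|i _]; last by rewrite mxE -expr2 sqr_ge0.
apply/colP => i; have := h i (mem_index_enum i).
by rewrite !mxE mulf_eq0 orbb => /eqP.
Qed.

(** A Cholesky factor [U] of [M^T M] makes [M U^-1] orthogonal, so a factorization exists and [xget]
    does not fall back on its default. *)
Lemma qr_QP n (M : 'M[R]_n) : M \in unitmx ->
  orthogonal_mx (qr_Q M) /\ exists2 U, upper_pos U & M = qr_Q M *m U.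
Proof.
move=> Mu; rewrite /qr_Q; case: xgetP => [Q -> //|/= noQ].
have [||U Uup UU] := @cholesky n (M^T *m M).
- by rewrite trmx_mul trmxK.
- move=> x x0; rewrite lt_def; apply/andP; split.
    apply: contra x0 => /eqP; rewrite mulmxA -trmx_mul -mulmxA => /mulTmx_eq0 Mx.
    by rewrite -(mulKmx Mu x) Mx mulmx0.
  rewrite mulmxA -trmx_mul -mulmxA mxE sumr_ge0 // => i _.
  by rewrite mxE -expr2 sqr_ge0.
have Uu : U \in unitmx.
  have : U^T *m U \in unitmx by rewrite UU unitmx_mul unitmx_tr Mu.
  by rewrite unitmx_mul => /andP[].
exfalso; apply: (noQ (M *m invmx U)); split; last by exists U => //; rewrite mulmxKV.
rewrite /orthogonal_mx /= trmx_mul mulmxA -(mulmxA _ M^T) -UU !mulmxA.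
by rewrite -trmx_mul mulmxV // trmx1 mul1mx mulmxV.
Qed.

End QR.

(** * Norm estimates *)

Section MatrixNorm.
Variable R : realType.

Lemma mx_entry_le_norm m n (M : 'M[R]_(m, n)) i j : `|M i j| <= `|M|.
Proof.
rewrite [leRHS]/Num.Def.normr /= mx_normrE.
by apply/bigmax_geP; right => /=; exists (i, j).
Qed.

Lemma mx_norm_le m n (M : 'M[R]_(m, n)) (c : R) :
  0 <= c -> (forall i j, `|M i j| <= c) -> `|M| <= c.
Proof.
move=> c0 Mc; rewrite [leLHS]/Num.Def.normr /= mx_normrE.
by apply: bigmax_le => // -[i j] _ /=.
Qed.

Lemma mx_norm_mul m n p (M : 'M[R]_(m, n)) (N : 'M[R]_(n, p)) :
  `|M *m N| <= n%:R * (`|M| * `|N|).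
Proof.
apply: mx_norm_le => [|i j]; first by rewrite mulr_ge0 ?mulr_ge0.
rewrite mxE; apply: le_trans (ler_norm_sum _ _ _) _.
apply: (@le_trans _ _ (\sum_(l < n) `|M| * `|N|)); last first.
  by rewrite sumr_const card_ord mulr_natl.
by apply: ler_sum => l _; rewrite normrM ler_pM ?mx_entry_le_norm.
Qed.

Lemma mx_norm_tr m n (M : 'M[R]_(m, n)) : `|M^T| <= `|M|.
Proof. by apply: mx_norm_le => // i j; rewrite mxE mx_entry_le_norm. Qed.

(** [B] is the inverse of the matrix of [f] in vectorized coordinates; an injective endomorphism in
    finite dimension is invertible. *)
Lemma injective_linear_onto m n (f : {linear 'M[R]_(m, n) -> 'M[R]_(m, n)}) :
  (forall X, f X = 0 -> X = 0) ->
  exists B : 'M[R]_(m * n), forall Y, f (vec_mx (mxvec Y *m B)) = Y /\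
    vec_mx (mxvec (f Y) *m B) = Y.
Proof.
move=> finj.
have u : lin_mx f \in unitmx.
  rewrite -row_free_unit -kermx_eq0; apply/rowV0P => v /sub_kermxP.
  rewrite mul_rV_lin => /(congr1 vec_mx); rewrite mxvecK linear0 => /finj v0.
  by rewrite -[v]vec_mxK v0 linear0.
exists (invmx (lin_mx f)) => Y; split.
  apply: (can_inj mxvecK); rewrite -mul_vec_lin vec_mxK mulmxKV //.
by rewrite -mul_vec_lin mulmxK // mxvecK.
Qed.

Lemma injective_linear_bounded_below m n (f : {linear 'M[R]_(m, n) -> 'M[R]_(m, n)}) :
  (forall X, f X = 0 -> X = 0) -> exists2 c, 0 < c & forall X, `|X| <= c * `|f X|.
Proof.
move=> /injective_linear_onto[B hB]; exists ((m * n)%:R * `|B| + 1).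
  by rewrite ltr_wpDl // mulr_ge0.
move=> X; rewrite -{1}(hB X).2; set Y := f X.
have vecl p q (M : 'M[R]_(p, q)) : `|mxvec M| <= `|M|.
  by apply: mx_norm_le => // i j; case/mxvec_indexP: j => x y; rewrite ord1 mxvecE mx_entry_le_norm.
have vecr p q (M : 'rV[R]_(p * q)) : `|vec_mx M| <= `|M|.
  by apply: mx_norm_le => // i j; rewrite mxE mx_entry_le_norm.
apply: le_trans (vecr _ _ _) (le_trans (mx_norm_mul _ _) _).
rewrite mulrDl mul1r -mulrA; apply: ler_wpDr => //.
by rewrite ler_wpM2l // mulrC ler_wpM2l.
Qed.

End MatrixNorm.

(** * Uniform orders of magnitude *)

Section Order.
Variables (R : realType) (T : Type) (ok : T -> Prop) (d : T -> R).
Hypothesis d01 : forall t, ok t -> 0 <= d t <= 1.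

(** A Landau symbol without limits: [f = O(d^e)] with one constant for all admissible parameters. *)
Definition is_O e m n (f : T -> 'M[R]_(m, n)) :=
  exists2 K, 0 <= K & forall t, ok t -> `|f t| <= K * d t ^+ e.

Lemma is_O_ext e m n (f g : T -> 'M[R]_(m, n)) :
  (forall t, ok t -> f t = g t) -> is_O e g -> is_O e f.
Proof. by move=> fg [K K0 h]; exists K => // t okt; rewrite fg ?h. Qed.

Lemma is_O_cst m n (M : 'M[R]_(m, n)) : is_O 0 (fun=> M).
Proof. by exists `|M| => // t _; rewrite expr0 mulr1. Qed.

Lemma is_OD e m n (f g : T -> 'M[R]_(m, n)) :
  is_O e f -> is_O e g -> is_O e (fun t => f t + g t).
Proof.
move=> [K K0 hK] [L L0 hL]; exists (K + L); first exact: addr_ge0.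
move=> t okt; rewrite mulrDl.
by apply: le_trans (ler_normD _ _) _; apply: lerD; [exact: hK|exact: hL].
Qed.

Lemma is_ON e m n (f : T -> 'M[R]_(m, n)) : is_O e f -> is_O e (fun t => - f t).
Proof. by move=> [K K0 hK]; exists K => // t okt; rewrite normrN hK. Qed.

Lemma is_O_tr e m n (f : T -> 'M[R]_(m, n)) : is_O e f -> is_O e (fun t => (f t)^T).
Proof.
by move=> [K K0 hK]; exists K => // t okt; apply: le_trans (mx_norm_tr _) (hK t okt).
Qed.

Lemma is_OM a b m n p (f : T -> 'M[R]_(m, n)) (g : T -> 'M[R]_(n, p)) :
  is_O a f -> is_O b g -> is_O (a + b) (fun t => f t *m g t).
Proof.
move=> [K K0 hK] [L L0 hL]; exists (n%:R * (K * L)); first by rewrite !mulr_ge0.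
move=> t okt; apply: le_trans (mx_norm_mul _ _) _.
rewrite -mulrA ler_wpM2l // exprD mulrACA.
by apply: ler_pM => //; [exact: hK|exact: hL].
Qed.

Lemma is_O_weaken a b m n (f : T -> 'M[R]_(m, n)) : (b <= a)%N -> is_O a f -> is_O b f.
Proof.
move=> ab [K K0 hK]; exists K => // t okt; apply: le_trans (hK t okt) _.
have /andP[d0 d1] := d01 okt.
by rewrite ler_wpM2l // -(subnK ab) exprD ler_piMl ?exprn_ge0 ?exprn_ile1.
Qed.

(** Boundedness is included so that the relation passes to products, hence to every polynomial
    expression in matrices and their transposes. *)
Definition is_close m n (f g : T -> 'M[R]_(m, n)) :=
  [/\ is_O 0 f, is_O 0 g & is_O 1 (fun t => f t - g t)].

Lemma is_close_same m n (f : T -> 'M[R]_(m, n)) : is_O 0 f -> is_close f f.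
Proof.
move=> h; split => //; exists 0 => // t _.
by rewrite subrr normr0 mul0r.
Qed.

Lemma is_closeD m n (f g f' g' : T -> 'M[R]_(m, n)) : is_close f f' -> is_close g g' ->
  is_close (fun t => f t + g t) (fun t => f' t + g' t).
Proof.
move=> [f1 f2 f3] [g1 g2 g3]; split; [exact: is_OD|exact: is_OD|].
by apply: is_O_ext (is_OD f3 g3) => t _; rewrite opprD addrACA.
Qed.

Lemma is_closeN m n (f f' : T -> 'M[R]_(m, n)) : is_close f f' ->
  is_close (fun t => - f t) (fun t => - f' t).
Proof.
move=> [f1 f2 f3]; split; [exact: is_ON|exact: is_ON|].
by apply: is_O_ext (is_ON f3) => t _; rewrite opprD.
Qed.

Lemma is_close_tr m n (f f' : T -> 'M[R]_(m, n)) : is_close f f' ->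
  is_close (fun t => (f t)^T) (fun t => (f' t)^T).
Proof.
move=> [f1 f2 f3]; split; [exact: is_O_tr|exact: is_O_tr|].
by apply: is_O_ext (is_O_tr f3) => t _; rewrite raddfB.
Qed.

Lemma is_closeM m n p (f f' : T -> 'M[R]_(m, n)) (g g' : T -> 'M[R]_(n, p)) :
  is_close f f' -> is_close g g' ->
  is_close (fun t => f t *m g t) (fun t => f' t *m g' t).
Proof.
move=> [f1 f2 f3] [g1 g2 g3]; split; [exact: (is_OM f1 g1)|exact: (is_OM f2 g2)|].
apply: is_O_ext (is_OD (is_OM f3 g1) (is_OM f2 g3)) => t _.
by rewrite mulmxBl mulmxBr addrA subrK.
Qed.

End Order.

(** * The Newton operator on matrices *)

Ltac mx_abel := apply/matrixP => ? ?; rewrite !mxE; ring.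

Section NewtonOperator.
Variables (R : realType) (n : nat).
Implicit Types (A P X Y : 'M[R]_n).

Definition offdiag P X := P *m X *m (1%:M - P).

(** In coordinates adapted to [P], on an upper right block [Z], this is [Z |-> A11 Z - Z A22]. *)
Definition sylvester_op A P X := P *m A *m P *m X - X *m ((1%:M - P) *m A *m (1%:M - P)).

(* The left-hand side of the linear equation of step (ii), written in the original
   coordinates: there [Z] becomes [X = P X (1 - P)]. *)
Definition newton_op A P X :=
  let C := (1%:M - P) *m A *m P in
  let U := P *m A *m (1%:M - P) in
  sylvester_op A P (sylvester_op A^T P X)
  - C^T *m (X^T *m U + C *m X) - (U *m X^T + X *m C) *m C^T.

Lemma sylvester_op_linear A P : linear (sylvester_op A P).
Proof.
move=> c X Y; rewrite /sylvester_op; move: (_ *m P) (_ *m (1%:M - P)) => B D.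
by rewrite mulmxDr mulmxDl -scalemxAr -scalemxAl; mx_abel.
Qed.
HB.instance Definition _ A P :=
  GRing.isLinear.Build R 'M[R]_n 'M[R]_n *:%R (sylvester_op A P) (sylvester_op_linear A P).

Lemma newton_op_linear A P : linear (newton_op A P).
Proof.
move=> c X Y; rewrite /newton_op !linearP /=.
move: (sylvester_op _ _ (_ _ _ X)) (sylvester_op _ _ (_ _ _ Y)) => S1 S2.
move: ((1%:M - P) *m A *m P) (P *m A *m (1%:M - P)) => C U.
rewrite !(mulmxDr, mulmxDl) -!(scalemxAr, scalemxAl).
mx_abel.
Qed.
HB.instance Definition _ A P :=
  GRing.isLinear.Build R 'M[R]_n 'M[R]_n *:%R (newton_op A P) (newton_op_linear A P).

Lemma offdiag_linear P : linear (offdiag P).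
Proof.
move=> c X Y; rewrite /offdiag; move: (1%:M - P) => Q.
by rewrite mulmxDr mulmxDl -scalemxAr -scalemxAl.
Qed.
HB.instance Definition _ P :=
  GRing.isLinear.Build R 'M[R]_n 'M[R]_n *:%R (offdiag P) (offdiag_linear P).

(* Extended by the identity on the complement of the off-diagonal matrices, so that the
   domain does not depend on [P]. *)
Definition newton_op_ext A P X := newton_op A P (offdiag P X) + (X - offdiag P X).

Lemma newton_op_ext_linear A P : linear (newton_op_ext A P).
Proof. by move=> c X Y; rewrite /newton_op_ext !linearP /= !scalerDr; mx_abel. Qed.
HB.instance Definition _ A P :=
  GRing.isLinear.Build R 'M[R]_n 'M[R]_n *:%R (newton_op_ext A P) (newton_op_ext_linear A P).

Lemma offdiagE P X : P *m P = P -> offdiag P X = X -> P *m X = X /\ X *m P = 0.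
Proof.
move=> PP <-; rewrite /offdiag !mulmxA PP; split=> //.
by rewrite -mulmxA mulmxBl mul1mx PP subrr mulmx0.
Qed.

Lemma sylvester_op_offdiag A P X :
  P *m P = P -> offdiag P X = X -> offdiag P (sylvester_op A P X) = sylvester_op A P X.
Proof.
move=> PP /(offdiagE PP)[PX XP]; have XQ : X *m (1%:M - P) = X by rewrite mulmxBr mulmx1 XP subr0.
have QQ : (1%:M - P) *m (1%:M - P) = 1%:M - P.
  by rewrite mulmxBr mulmx1 [(_ - P) *m P]mulmxBl mul1mx PP subrr subr0.
move: XQ QQ; rewrite /offdiag /sylvester_op; move: (1%:M - P) => Q XQ QQ.
by rewrite mulmxBr mulmxBl !mulmxA PP PX -!mulmxA QQ XQ.
Qed.

(** * Injectivity at the projector onto the stable invariant subspace *)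

Section AtFixedPoint.
Variables (A P : 'M[R]_n) (V : {vspace 'cV[R]_n}).
Hypotheses (hV : stable_invariant_subspace A V) (hP : orthogonal_projector_onto V P).

(** For off-diagonal [X] the homogeneous Sylvester equation says that [X] commutes with this
    block-diagonal part of [A]. *)
Let Ad := P *m A *m P + (1%:M - P) *m A *m (1%:M - P).

Let PT : P^T = P. Proof. by case: hP. Qed.
Let PP : P *m P = P. Proof. by case: hP. Qed.
Let PQ : P *m (1%:M - P) = 0. Proof. by rewrite mulmxBr mulmx1 PP subrr. Qed.
Let QP : (1%:M - P) *m P = 0. Proof. by rewrite mulmxBl mul1mx PP subrr. Qed.

Let PAd : P *m Ad = Ad *m P.
Proof.
rewrite /Ad; move: (1%:M - P) PQ QP => Q pq qp.
by rewrite mulmxDr mulmxDl !mulmxA PP pq !mul0mx -!mulmxA PP qp !mulmx0.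
Qed.

Let AdX X : P *m X = X -> Ad *m X = P *m A *m P *m X.
Proof.
move=> PX; have QX : (1%:M - P) *m X = 0 by rewrite mulmxBl mul1mx PX subrr.
by rewrite /Ad; move: (1%:M - P) QX => Q QX; rewrite mulmxDl -!mulmxA QX !mulmx0 addr0.
Qed.

Let XAd X : X *m P = 0 -> X *m Ad = X *m ((1%:M - P) *m A *m (1%:M - P)).
Proof. by move=> XP; rewrite /Ad [LHS]mulmxDr !mulmxA XP !mul0mx add0r. Qed.

Let AdX' X : P *m X = 0 -> Ad *m X = (1%:M - P) *m A *m (1%:M - P) *m X.
Proof. by move=> PX; rewrite /Ad [LHS]mulmxDl -!mulmxA PX !mulmx0 add0r. Qed.

Let XAd' X : X *m P = X -> X *m Ad = X *m (P *m A *m P).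
Proof.
move=> XP; have XQ : X *m (1%:M - P) = 0 by rewrite mulmxBr mulmx1 XP subrr.
by rewrite /Ad; move: (1%:M - P) XQ => Q XQ; rewrite mulmxDr !mulmxA XQ !mul0mx addr0.
Qed.

Lemma stable_invariant_dl0 : (1%:M - P) *m A *m P = 0.
Proof.
case: hV => inv _; rewrite -mulmxA mulmxBl mul1mx mulmxA.
by rewrite (invariant_subspace_projector inv hP) subrr.
Qed.

Lemma sylvester_op_inj X : offdiag P X = X -> sylvester_op A P X = 0 -> X = 0.
Proof.
move=> /(offdiagE PP)[PX XP] /eqP; rewrite subr_eq0 => /eqP eqX.
have eq0 : complexify X = 0 -> X = 0.
  move=> /matrixP X0; apply/matrixP => i j; have := X0 i j; rewrite !mxE.
  by move/(congr1 (@complex.Re R)).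
apply: eq0; apply: (@commuting_offdiag_eq0 _ n (complexify Ad) (complexify P)).
- by rewrite -!map_mxM PAd.
- exact: (stable_blockdiag_dichotomy hV hP).
- by rewrite -map_mxM PX.
- by rewrite -map_mxM XP map_mx0.
by rewrite -!map_mxM AdX // XAd // eqX.
Qed.

(** Transposing, [X^T] commutes with [Ad] and is off-diagonal for [1 - P], so the argument for [A]
    applies with the two cases of the dichotomy exchanged. *)
Lemma sylvester_op_tr_inj X : offdiag P X = X -> sylvester_op A^T P X = 0 -> X = 0.
Proof.
move=> /(offdiagE PP)[PX XP] /eqP; rewrite subr_eq0 => /eqP eqX.
have {}PX : X^T *m P = X^T by rewrite -{1}PT -trmx_mul PX.
have {}XP : P *m X^T = 0 by rewrite -{1}PT -trmx_mul XP trmx0.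
have {}eqX : X^T *m (P *m A *m P) = (1%:M - P) *m A *m (1%:M - P) *m X^T.
  have := congr1 trmx eqX; rewrite !trmx_mul !trmxK PT raddfB /= trmx1 PT => e.
  by rewrite !mulmxA in e *.
have eq0 : complexify X^T = 0 -> X = 0.
  move=> /matrixP X0; apply/matrixP => i j; have := X0 j i; rewrite !mxE.
  by move/(congr1 (@complex.Re R)).
apply: eq0; apply: (@commuting_offdiag_eq0 _ n (complexify Ad) (complexify (1%:M - P))).
- by rewrite -!map_mxM mulmxBl mulmxBr mul1mx mulmx1 PAd.
- move=> lambda; rewrite /complexify map_mxB map_mx1 subKr.
  by case: (stable_blockdiag_dichotomy hV hP lambda); [right|left].
- by rewrite -map_mxM mulmxBl mul1mx XP subr0.
- by rewrite -map_mxM mulmxBr mulmx1 PX subrr map_mx0.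
by rewrite -!map_mxM AdX' // XAd' // eqX.
Qed.

(** By invariance the lower left block of [A] vanishes, which leaves the composite of two Sylvester
    operators, both injective on off-diagonal matrices. *)
Lemma newton_op_ext_inj X : newton_op_ext A P X = 0 -> X = 0.
Proof.
set Y := offdiag P X; have QQ : (1%:M - P) *m (1%:M - P) = 1%:M - P.
  by rewrite mulmxBr mulmx1 QP subr0.
have YY : offdiag P Y = Y by rewrite /Y /offdiag !mulmxA PP -!mulmxA QQ.
rewrite /newton_op_ext /newton_op stable_invariant_dl0 trmx0 !mul0mx !mulmx0 !subr0 -/Y => e.
have LL : sylvester_op A P (sylvester_op A^T P Y) = 0.
  (* The projection [offdiag P] kills [X - Y], which separates the two summands of the extended
     operator. *)
  have gen Z : offdiag P Z = Z -> Z + (X - Y) = 0 -> Z = 0.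
    move=> PZ /(congr1 (offdiag P)); rewrite raddfD raddfB /= -/Y YY PZ.
    by rewrite subrr addr0 raddf0.
  by apply: gen e; rewrite !sylvester_op_offdiag.
have Y0 : Y = 0.
  apply: sylvester_op_tr_inj => //; apply: sylvester_op_inj => //.
  exact: sylvester_op_offdiag.
by move: e; rewrite LL Y0 add0r subr0.
Qed.

End AtFixedPoint.

End NewtonOperator.

(** * Uniform invertibility of the Newton operator near the limit *)

Section LocalAnalysis.
Variables (R : realType) (n : nat) (A Ps : 'M[R]_n) (V : {vspace 'cV[R]_n}).
Hypotheses (hV : stable_invariant_subspace A V) (hPs : orthogonal_projector_onto V Ps).

(** The operator is polynomial in [P], which bounds the difference for [X] in the unit ball;
    linearity in [X] then supplies the factor [|X|]. *)
Lemma newton_op_ext_lipschitz :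
  exists2 K : R, 0 <= K & forall P X : 'M[R]_n, `|P - Ps| <= 1 ->
    `|newton_op_ext A P X - newton_op_ext A Ps X| <= K * `|P - Ps| * `|X|.
Proof.
pose ok (t : 'M[R]_n * 'M[R]_n) := `|t.1 - Ps| <= 1 /\ `|t.2| <= 1.
pose d (t : 'M[R]_n * 'M[R]_n) := `|t.1 - Ps|.
have cK m p (M : 'M[R]_(m, p)) : is_close ok d (fun=> M) (fun=> M).
  exact/is_close_same/is_O_cst.
have cX : is_close ok d snd snd.
  by apply: is_close_same; exists 1 => // t [_ h]; rewrite expr0 mul1r.
have cP : is_close ok d fst (fun=> Ps).
  split; [|exact: is_O_cst|by exists 1 => // t _; rewrite expr1 mul1r].
  exists (`|Ps| + 1); first exact: addr_ge0.
  move=> t [h _]; rewrite expr0 mulr1 -[t.1](subrK Ps) addrC.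
  by apply: le_trans (ler_normD _ _) _; rewrite lerD2l.
have [_ _ [K K0 hK]] : is_close ok d (fun t => newton_op_ext A t.1 t.2)
    (fun t => newton_op_ext A Ps t.2).
  rewrite /newton_op_ext /newton_op /sylvester_op /offdiag.
  by do ![exact: cK | exact: cX | exact: cP | apply: is_closeD | apply: is_closeN
    | apply: is_closeM | apply: is_close_tr].
have ext0 P : newton_op_ext A P 0 = 0 by exact: linear0.
have extZ P a X : newton_op_ext A P (a *: X) = a *: newton_op_ext A P X by exact: linearZ.
exists K => // P X hP; have [->|X0] := eqVneq X 0.
  by rewrite !ext0 subrr !normr0 mulr0.
have nX : 0 < `|X| by rewrite normr_gt0.
have /hK : ok (P, `|X|^-1 *: X).
  by split => //=; rewrite normrZ ger0_norm ?invr_ge0 // mulVf ?gt_eqF.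
rewrite /= !extZ -scalerBr normrZ ger0_norm ?invr_ge0 // expr1.
by rewrite mulrC ler_pdivrMr.
Qed.

(** A bound [|X| <= c |L X|] for the operator [L] at [Ps] survives a small perturbation, at the
    price of doubling [c]. *)
Lemma newton_op_coercive :
  exists delta c : R, [/\ 0 < delta, delta <= 1, 0 < c &
    forall P X : 'M[R]_n, `|P - Ps| <= delta -> offdiag P X = X ->
      `|X| <= c * `|newton_op A P X| ].
Proof.
have [c c0 hc] := injective_linear_bounded_below (newton_op_ext_inj hV hPs).
have [K K0 hK] := newton_op_ext_lipschitz.
(* The radius gives [c K |P - Ps| <= 1/2], so the perturbation term is absorbed by half of [|X|];
   the [+ 1] avoids division by zero. *)
exists (Num.min 1 (2 * c * K + 1)^-1), (2 * c).
have pos : 0 < 2 * c * K + 1 by rewrite ltr_wpDl // !mulr_ge0 // ltW.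
split; [by rewrite lt_min ltr01 invr_gt0|by rewrite ge_min lexx|by rewrite mulr_gt0|].
move=> P X; rewrite le_min => /andP[hP1 hP2] offX.
have -> : newton_op A P X = newton_op_ext A P X.
  by rewrite /newton_op_ext offX subrr addr0.
have h1 := hc X; have h2 := hK P X hP1.
have h3 : `|newton_op_ext A Ps X| <= `|newton_op_ext A P X| + K * `|P - Ps| * `|X|.
  rewrite distrC in h2; rewrite -lerBlDl.
  by apply: le_trans h2; apply: le_trans (lerB_dist _ _).
have h4 : 2 * c * (K * `|P - Ps|) <= 1.
  have : (2 * c * K + 1) * `|P - Ps| <= 1 by rewrite -ler_pdivlMl ?mulr1.
  have := normr_ge0 (P - Ps); nra.
have := ler_wpM2l (ltW c0) h3; have := normr_ge0 X; nra.
Qed.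

End LocalAnalysis.

(** * Identities for the difference of two projectors *)

Section ProjectorAlgebra.
Variables (R : realType) (n : nat) (A P Ps Q D : 'M[R]_n).
Hypotheses (PP : P *m P = P) (PsPs : Ps *m Ps = Ps).
Hypotheses (DQ : 1%:M - P = Q) (DD : P - Ps = D).

Let one : 1%:M = P + Q. Proof. by rewrite -DQ addrC subrK. Qed.
Let QQ : Q *m Q = Q.
Proof. by rewrite -DQ mulmxBr mulmx1 mulmxBl mul1mx PP subrr subr0. Qed.
Let QP : Q *m P = 0. Proof. by rewrite -DQ mulmxBl mul1mx PP subrr. Qed.
Let PQ : P *m Q = 0. Proof. by rewrite -DQ mulmxBr mulmx1 PP subrr. Qed.
Let PsE : Ps = P - D. Proof. by rewrite -DD subKr. Qed.
Let QPs : Q *m Ps = - (Q *m D). Proof. by rewrite PsE mulmxBr QP sub0r. Qed.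
Let PsQ : Ps *m Q = - (D *m Q). Proof. by rewrite PsE mulmxBl PQ sub0r. Qed.

Let QPsQ : Q *m Ps *m Q = Q *m D *m D *m Q.
Proof. by rewrite -{1}PsPs mulmxA -mulmxA PsQ QPs mulmxN mulNmx opprK mulmxA. Qed.

(** The diagonal blocks of [D] are quadratic in [D]: [Q Ps Q = - Q D Q] and [P (1 - Ps) P = P D P],
    and inserting the squares of the idempotents [Ps] and [1 - Ps] produces a second factor [D]. *)
Lemma projector_diff_offdiag :
  D - P *m D *m Q - Q *m D *m P = P *m D *m D *m P - Q *m D *m D *m Q.
Proof.
have QDQ : Q *m D *m Q = - (Q *m D *m D *m Q).
  by rewrite -QPsQ QPs mulNmx opprK.
have PDP : P *m D *m P = P *m D *m D *m P.
  have PcPc : (1%:M - Ps) *m (1%:M - Ps) = 1%:M - Ps.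
    by rewrite mulmxBr mulmx1 [_ *m Ps]mulmxBl mul1mx PsPs subrr subr0.
  have PPc : P *m (1%:M - Ps) = P *m D by rewrite -DD !mulmxBr mulmx1 PP.
  have PcP : (1%:M - Ps) *m P = D *m P by rewrite -DD !mulmxBl mul1mx PP.
  by rewrite -PPc -{1}PcPc !mulmxA PPc -!mulmxA PcP !mulmxA.
have eD : D = P *m D *m P + P *m D *m Q + (Q *m D *m P + Q *m D *m Q).
  by rewrite -!mulmxDr -!mulmxDl -one mul1mx mulmx1.
by rewrite {1}eD QDQ PDP; mx_abel.
Qed.

(** The left side is the linearized invariance equation, evaluated at [B]. The identity comes from
    expanding [Q A Ps P] twice, once as it stands and once with [A Ps] replaced by [Ps A Ps]. *)
Lemma invariance_defect_expansion (C := Q *m A *m P) (B := Q *m D *m P) :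
  Ps *m A *m Ps = A *m Ps ->
  C - Q *m A *m Q *m B + B *m (P *m A *m P) =
  C *m D *m P + B *m A *m D *m P + Q *m D *m D *m Q *m A *m Ps *m P.
Proof.
move=> inv.
have e1 : Q *m A *m Ps *m P = C - C *m D *m P - Q *m A *m Q *m B.
  have -> : Q *m A *m Ps *m P = Q *m A *m P *m Ps *m P + Q *m A *m Q *m Ps *m P.
    by rewrite -!mulmxDl -mulmxDr -one mulmx1.
  rewrite /B !mulmxA -[Q *m A *m Q *m Q]mulmxA QQ.
  rewrite -[Q *m A *m Q *m Ps]mulmxA QPs PsE mulmxBr mulmxBl.
  by rewrite -[_ *m P *m P]mulmxA PP -[_ *m P *m P]mulmxA PP mulmxN !mulNmx -/C !mulmxA.
have e2 : Q *m A *m Ps *m P = - (B *m (P *m A *m P)) + B *m A *m D *m P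
    + Q *m D *m D *m Q *m A *m Ps *m P.
  rewrite -[Q *m A *m Ps]mulmxA -inv -[Ps *m A *m Ps]mulmxA.
  have -> : Q *m (Ps *m (A *m Ps)) *m P =
      Q *m Ps *m P *m A *m Ps *m P + Q *m Ps *m Q *m A *m Ps *m P.
    by rewrite -!mulmxDl -mulmxDr -one mulmx1 !mulmxA.
  rewrite QPsQ QPs mulNmx -/B; congr (_ + _).
  rewrite PsE mulmxBr mulmxBl !mulNmx opprK !mulmxA.
  by rewrite /B -[_ *m P *m P]mulmxA PP -[_ *m P *m P]mulmxA PP.
have := e1; rewrite e2 => /eqP; rewrite -subr_eq0 => /eqP e.
rewrite -[LHS]addr0 -{1}e; mx_abel.
Qed.

End ProjectorAlgebra.

(** * Quadratic error of one step *)

Section QuadraticStep.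
Variables (R : realType) (n : nat) (A Ps : 'M[R]_n) (V : {vspace 'cV[R]_n}).
Hypotheses (hV : stable_invariant_subspace A V) (hPs : orthogonal_projector_onto V Ps).

Lemma newton_step_quadratic :
  exists delta K : R, [/\ 0 < delta, 0 <= K &
    forall P X P1 : 'M[R]_n, P^T = P -> P *m P = P -> `|P - Ps| <= delta ->
      offdiag P X = X ->
      newton_op A P X = - sylvester_op A P ((1%:M - P) *m A *m P)^T ->
      P1 *m (1%:M + X - X^T) = (1%:M + X - X^T) *m P ->
      `|P1 - Ps| <= K * `|P - Ps| ^+ 2].
Proof.
have [PsT PsPs _] := hPs.
have inv : Ps *m A *m Ps = A *m Ps.
  by case: hV => inv _; apply: invariant_subspace_projector inv hPs.
have [delta [c [delta0 delta1 c0 coer]]] := newton_op_coercive hV hPs.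
pose ok (t : 'M[R]_n * 'M[R]_n) := [/\ t.1^T = t.1, t.1 *m t.1 = t.1, `|t.1 - Ps| <= delta,
  offdiag t.1 t.2 = t.2 &
  newton_op A t.1 t.2 = - sylvester_op A t.1 ((1%:M - t.1) *m A *m t.1)^T].
pose d (t : 'M[R]_n * 'M[R]_n) := `|t.1 - Ps|.
have d01 t : ok t -> 0 <= d t <= 1.
  by case=> _ _ h _ _; rewrite normr_ge0 (le_trans h).
have Ocst p q (M : 'M[R]_(p, q)) : is_O ok d 0 (fun=> M) by exact: is_O_cst.
have OD1 : is_O ok d 1 (fun t => t.1 - Ps).
  by exists 1 => // t _; rewrite mul1r expr1.
have OP : is_O ok d 0 (fun t => t.1).
  apply: (is_O_ext (g := fun t => Ps + (t.1 - Ps))) => [t _|]; first by rewrite addrC subrK.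
  exact: is_OD (Ocst _ _ _) (is_O_weaken d01 _ OD1).
have OQ : is_O ok d 0 (fun t => 1%:M - t.1) by exact: is_OD (Ocst _ _ _) (is_ON OP).
pose C (t : 'M[R]_n * 'M[R]_n) := (1%:M - t.1) *m A *m t.1.
pose Xs (t : 'M[R]_n * 'M[R]_n) := offdiag t.1 (t.1 - Ps).
have OC : is_O ok d 1 C.
  (* Since [(1 - Ps) A Ps = 0], the product [(1 - P) A Ps] equals [- (P - Ps) A Ps]; so the lower
     left block is of first order. *)
  apply: (is_O_ext (g := fun t => (1%:M - t.1) *m A *m (t.1 - Ps) - (t.1 - Ps) *m (A *m Ps))).
    move=> t _; rewrite /C mulmxBr -addrA -opprD; set a := _ *m t.1.
    rewrite [X in _ - X](_ : _ = 0) ?subr0 //.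
    by rewrite !mulmxBl mul1mx !mulmxA inv addrA subrK subrr.
  apply: is_OD; first exact: is_OM (is_OM OQ (Ocst _ _ A)) OD1.
  exact/is_ON/(is_OM OD1 (Ocst _ _ _)).
have OXs : is_O ok d 1 Xs by exact: is_OM (is_OM OP OD1) OQ.
have trB (X Y : 'M[R]_n) : (X - Y)^T = X^T - Y^T by exact: raddfB.
have trD (X Y : 'M[R]_n) : (X + Y)^T = X^T + Y^T by exact: raddfD.
have XsT t : ok t -> (Xs t)^T = (1%:M - t.1) *m (t.1 - Ps) *m t.1.
  by case=> PT _ _ _ _; rewrite /Xs /offdiag !trmx_mul !trB trmx1 PT PsT mulmxA.
(* The transposed invariance defect: the inner Sylvester operator maps the true off-diagonal part
   [Xs] to [- C^T] up to second order. *)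
have Odefect : is_O ok d 2 (fun t => sylvester_op A^T t.1 (Xs t) + (C t)^T).
  pose B (t : 'M[R]_n * 'M[R]_n) := (Xs t)^T.
  pose f t := C t *m (t.1 - Ps) *m t.1 + B t *m A *m (t.1 - Ps) *m t.1
     + (1%:M - t.1) *m (t.1 - Ps) *m (t.1 - Ps) *m (1%:M - t.1) *m A *m Ps *m t.1.
  apply: (is_O_ext (g := fun t => (f t)^T)) => [t okt|]; last first.
    apply: is_O_tr; apply: is_OD; first apply: is_OD.
    - exact: is_OM (is_OM OC OD1) OP.
    - exact: is_OM (is_OM (is_OM (is_O_tr OXs) (Ocst _ _ A)) OD1) OP.
    exact: is_OM (is_OM (is_OM (is_OM (is_OM (is_OM OQ OD1) OD1) OQ) (Ocst _ _ A)) (Ocst _ _ Ps)) OP.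
  have [PT PP _ _ _] := okt.
  rewrite /f /B XsT // -(invariance_defect_expansion PP PsPs erefl erefl inv) -XsT // -/(C t).
  have sand M : M^T = M -> (M *m A *m M)^T = M *m A^T *m M.
    by move=> MT; rewrite !trmx_mul MT mulmxA.
  have QT : (1%:M - t.1)^T = 1%:M - t.1 by rewrite trB trmx1 PT.
  rewrite [RHS]trD trB !(trmx_mul _ (Xs t)^T, trmx_mul (Xs t)^T) trmxK !sand //.
  by rewrite /sylvester_op [LHS]addrC addrA [RHS]addrAC.
have Osyl e (f : _ -> 'M[R]_n) : is_O ok d e f -> is_O ok d e (fun t => sylvester_op A t.1 (f t)).
  move=> Of; apply: is_OD.
    exact: (is_OM (is_OM (is_OM OP (Ocst _ _ A)) OP) Of).
  apply: is_ON; rewrite -(addn0 e).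
  exact: (is_OM Of (is_OM (is_OM OQ (Ocst _ _ A)) OQ)).
have Onewton : is_O ok d 2 (fun t => newton_op A t.1 (t.2 - Xs t)).
  pose U (t : 'M[R]_n * 'M[R]_n) := t.1 *m A *m (1%:M - t.1).
  have OU : is_O ok d 0 U by exact: is_OM (is_OM OP (Ocst _ _ A)) OQ.
  (* Newton's equation for [X] replaces its image by [- sylvester_op] of [C^T]. The rest is the
     image of the defect plus products of first-order factors [C] and [Xs]. *)
  apply: (is_O_ext (g := fun t => - sylvester_op A t.1 (sylvester_op A^T t.1 (Xs t) + (C t)^T)
    + (C t)^T *m ((Xs t)^T *m U t + C t *m Xs t) + (U t *m (Xs t)^T + Xs t *m C t) *m (C t)^T)).
    move=> t [_ _ _ _ Neq].
    have -> : newton_op A t.1 (t.2 - Xs t) = newton_op A t.1 t.2 - newton_op A t.1 (Xs t).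
      exact: linearB.
    rewrite Neq /newton_op -/(C t) -/(U t).
    have sD M N : sylvester_op A t.1 (M + N) = sylvester_op A t.1 M + sylvester_op A t.1 N.
      exact: linearD.
    rewrite (sD (sylvester_op A^T t.1 (Xs t))).
    by move: (sylvester_op A t.1 (C t)^T) (sylvester_op A t.1 (sylvester_op A^T t.1 (Xs t)))
      => M N; mx_abel.
  apply: is_OD; first apply: is_OD.
  - exact/is_ON/Osyl.
  - apply: (@is_OM _ _ _ _ 1 1); first exact: is_O_tr.
    apply: is_OD; first exact: (is_OM (is_O_tr OXs) OU).
    by apply: (is_O_weaken d01 (a := 2)) => //; exact: (is_OM OC OXs).
  - apply: (@is_OM _ _ _ _ 1 1); last exact: is_O_tr.
    apply: is_OD; first exact: (is_OM OU (is_O_tr OXs)).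
    by apply: (is_O_weaken d01 (a := 2)) => //; exact: (is_OM OXs OC).
(* Coercivity applies because [X - Xs] is off-diagonal. *)
have OXXs : is_O ok d 2 (fun t => t.2 - Xs t).
  have [K K0 hK] := Onewton; exists (c * K); first by rewrite mulr_ge0 // ltW.
  move=> t okt; have [PT PP hd offX _] := okt.
  apply: le_trans (coer _ _ hd _) _; last by rewrite -mulrA ler_pM2l // hK.
  have -> : offdiag t.1 (t.2 - Xs t) = offdiag t.1 t.2 - offdiag t.1 (Xs t) by exact: linearB.
  rewrite offX; congr (_ - _); rewrite /Xs /offdiag !mulmxA PP -!mulmxA.
  by do 2!congr (_ *m _); rewrite mulmxBr mulmx1 [_ *m t.1]mulmxBl mul1mx PP subrr subr0.
have OX : is_O ok d 1 (fun t => t.2).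
  apply: (is_O_ext (g := fun t => (t.2 - Xs t) + Xs t)) => [t _|]; first by rewrite subrK.
  exact: is_OD (is_O_weaken d01 _ OXXs) OXs.
have OS : is_O ok d 1 (fun t => t.2 - t.2^T) by exact: is_OD OX (is_ON (is_O_tr OX)).
(* With [Xs] in place of [X], the first three terms are the diagonal blocks of [P - Ps], which are
   quadratic. *)
have OE : is_O ok d 2 (fun t => (t.1 - Ps) - t.2 - t.2^T + (t.1 - Ps) *m (t.2 - t.2^T)).
  apply: is_OD; last exact: (is_OM OD1 OS).
  pose g (t : 'M[R]_n * 'M[R]_n) := t.1 *m (t.1 - Ps) *m (t.1 - Ps) *m t.1
    - (1%:M - t.1) *m (t.1 - Ps) *m (t.1 - Ps) *m (1%:M - t.1)
    - (t.2 - Xs t) - (t.2 - Xs t)^T.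
  apply: (is_O_ext (g := g)) => [t okt|].
    have [PT PP _ _ _] := okt.
    rewrite /g -(projector_diff_offdiag PP PsPs erefl erefl) -XsT // trB -/(offdiag _ _) -/(Xs t).
    by move: (Xs t) => M; mx_abel.
  apply: is_OD; last exact/is_ON/is_O_tr.
  apply: is_OD; last exact/is_ON.
  apply: is_OD; first exact: is_OM (is_OM (is_OM OP OD1) OD1) OP.
  exact/is_ON/(is_OM (is_OM (is_OM OQ OD1) OD1) OQ).
have [K1 K10 hK1] := OS; have [K2 K20 hK2] := OE.
pose L : R := n%:R * K1.
have L0 : 0 <= L by rewrite mulr_ge0.
have L1 : 0 < 2 * L + 1 by rewrite ltr_wpDl // mulr_ge0.
(* [L |P - Ps|] bounds the effect of right multiplication by [S = X - X^T]; the radius keeps it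
   below 1/2, so [W + W S] controls [W] up to a factor 2. *)
exists (Num.min delta (2 * L + 1)^-1), (2 * K2); split.
- by rewrite lt_min delta0 invr_gt0.
- by rewrite mulr_ge0.
move=> P X P1 PT PP; rewrite le_min => /andP[hd hd2] offX Neq P1G.
have okt : ok (P, X) by [].
have := hK1 _ okt; have := hK2 _ okt; rewrite /d /= expr1.
set W := P1 - Ps; set S := X - X^T.
have -> : P - Ps - X - X^T + (P - Ps) *m S = W + W *m S.
  have [PX XP] := offdiagE PP offX.
  have SP : S *m P = - X^T by rewrite mulmxBl XP -{1}PT -trmx_mul PX sub0r.
  have PS : P *m S = X by rewrite mulmxBr PX -{1}PT -trmx_mul XP trmx0 subr0.
  move: P1G; rewrite -addrA -/S mulmxDr mulmxDl mulmx1 mul1mx SP => /eqP.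
  rewrite -subr_eq0 => /eqP P1G.
  rewrite /W !mulmxBl PS -[RHS]subr0 -P1G; mx_abel.
move=> hE hS.
have hWS : `|W *m S| <= L * `|P - Ps| * `|W|.
  apply: le_trans (mx_norm_mul _ _) _; rewrite /L -!mulrA ler_wpM2l // mulrC.
  by rewrite mulrA ler_wpM2r.
have hW : `|W| <= K2 * `|P - Ps| ^+ 2 + `|W *m S|.
  rewrite -lerBlDr; apply: le_trans hE.
  by have := lerB_dist W (- (W *m S)); rewrite normrN opprK.
have hL : 2 * (L * `|P - Ps|) <= 1.
  have : (2 * L + 1) * `|P - Ps| <= 1 by rewrite -ler_pdivlMl ?mulr1.
  have := normr_ge0 (P - Ps); nra.
have := normr_ge0 W; nra.
Qed.

End QuadraticStep.

(** * The algorithm in block coordinates *)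

Section Coordinates.
Variables (R : realType) (n : nat) (Th : 'M[R]_n).
Hypothesis oTh : orthogonal_mx Th.
Implicit Types M N B P X : 'M[R]_n.

(** The passage from block coordinates in the frame [Th] back to the original coordinates; for
    orthogonal [Th] it respects products, sums and transposes. *)
Definition conj_by M := Th^T *m M *m Th.

Lemma orthogonal_mulmxT : Th *m Th^T = 1%:M.
Proof. exact: mulmx1C. Qed.

Lemma conj_byM M N : conj_by M *m conj_by N = conj_by (M *m N).
Proof. by rewrite /conj_by !mulmxA -(mulmxA _ Th Th^T) orthogonal_mulmxT mulmx1. Qed.

Lemma conj_by1 : conj_by 1%:M = 1%:M.
Proof. by rewrite /conj_by mulmx1. Qed.

Lemma conj_byD M N : conj_by M + conj_by N = conj_by (M + N).
Proof. by rewrite /conj_by mulmxDr mulmxDl. Qed.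

Lemma conj_byN M : - conj_by M = conj_by (- M).
Proof. by rewrite /conj_by mulmxN mulNmx. Qed.

Lemma conj_by_tr M : (conj_by M)^T = conj_by M^T.
Proof. by rewrite /conj_by !trmx_mul trmxK mulmxA. Qed.

Lemma conj_by_inj : injective conj_by.
Proof.
move=> M N /(congr1 (fun X => Th *m X *m Th^T)); rewrite /conj_by !mulmxA.
by rewrite orthogonal_mulmxT !mul1mx -!mulmxA orthogonal_mulmxT !mulmx1.
Qed.

Lemma conj_byK A : conj_by (Th *m A *m Th^T) = A.
Proof. by rewrite /conj_by !mulmxA oTh mul1mx -mulmxA oTh mulmx1. Qed.

Definition conj_byE := (conj_byM, conj_byD, conj_byN, conj_by_tr).

Lemma conj_by_complement P : 1%:M - conj_by P = conj_by (1%:M - P).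
Proof. by rewrite -{1}conj_by1 conj_byN conj_byD. Qed.

Lemma offdiag_conj P X : offdiag (conj_by P) (conj_by X) = conj_by (offdiag P X).
Proof. by rewrite /offdiag conj_by_complement !conj_byE. Qed.

Lemma sylvester_op_conj B P X :
  sylvester_op (conj_by B) (conj_by P) (conj_by X) = conj_by (sylvester_op B P X).
Proof. by rewrite /sylvester_op conj_by_complement !conj_byE. Qed.

Lemma newton_op_conj B P X :
  newton_op (conj_by B) (conj_by P) (conj_by X) = conj_by (newton_op B P X).
Proof.
by rewrite /newton_op conj_by_complement !(conj_by_tr, sylvester_op_conj) !conj_byE.
Qed.

End Coordinates.

(** * Block form of the Newton equation and of the retraction *)

Section Blocks.
Variables (R : realType) (m k : nat).
Implicit Types (A Th : 'M[R]_(m + k)) (Z : 'M[R]_(m, k)).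

Definition coord_projector : 'M[R]_(m + k) := block_mx 1%:M 0 0 0.
Definition ur_block Z : 'M[R]_(m + k) := block_mx 0 Z 0 0.

Lemma coord_projector_complement :
  1%:M - coord_projector = block_mx 0 0 0 1%:M.
Proof.
by rewrite scalar_mx_block opp_block_mx add_block_mx !oppr0 !addr0 subrr.
Qed.

Let simp := (mulmx_block, tr_block_mx, opp_block_mx, add_block_mx, trmx0, trmx1,
  mulmx0, mul0mx, mulmx1, mul1mx, addr0, add0r, oppr0).

Lemma sylvester_op_block (B11 : 'M[R]_m) B12 B21 (B22 : 'M[R]_k) Z :
  sylvester_op (block_mx B11 B12 B21 B22) coord_projector (ur_block Z) =
  ur_block (B11 *m Z - Z *m B22).
Proof.
by rewrite /sylvester_op coord_projector_complement /coord_projector /ur_block !simp.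
Qed.

Lemma newton_op_block (B11 : 'M[R]_m) B12 B21 (B22 : 'M[R]_k) Z :
  newton_op (block_mx B11 B12 B21 B22) coord_projector (ur_block Z) =
  ur_block (B11 *m (B11^T *m Z - Z *m B22^T) - (B11^T *m Z - Z *m B22^T) *m B22
    - B21^T *m (Z^T *m B12 + B21 *m Z) - (B12 *m Z^T + Z *m B21) *m B21^T).
Proof.
rewrite /newton_op tr_block_mx !sylvester_op_block.
by rewrite coord_projector_complement /coord_projector /ur_block !simp.
Qed.

Lemma ur_block_inj : injective ur_block.
Proof. by move=> Z Z' /eq_block_mx[]. Qed.

Lemma proj_ofE Th : proj_of Th = conj_by Th coord_projector.
Proof. by []. Qed.

Lemma coord_projectorM : coord_projector *m coord_projector = coord_projector.
Proof. by rewrite /coord_projector !simp. Qed.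

Lemma coord_projector_tr : coord_projector^T = coord_projector.
Proof. by rewrite /coord_projector !simp. Qed.

(** The left-hand side in [newton_eq], isolated as a function of [Z] so that it can be used as a
    linear map. *)
Definition newton_lhs A Th Z : 'M[R]_(m, k) :=
  let B := Th *m A *m Th^T in
  let A11 := ulsubmx B in
  let A12 := ursubmx B in
  let A21 := dlsubmx B in
  let A22 := drsubmx B in
  A11 *m (A11^T *m Z - Z *m A22^T) - (A11^T *m Z - Z *m A22^T) *m A22
  - A21^T *m (Z^T *m A12 + A21 *m Z) - (A12 *m Z^T + Z *m A21) *m A21^T.

Lemma newton_lhs_linear A Th : linear (newton_lhs A Th).
Proof.
move=> c X Y; rewrite /newton_lhs; set B := _ *m _ *m _.
move: (ulsubmx B) (ursubmx B) (dlsubmx B) (drsubmx B) => A11 A12 A21 A22.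
rewrite !linearP /=.
rewrite !(mulmxDr, mulmxDl, mulmxN, mulNmx) -!(scalemxAr, scalemxAl).
mx_abel.
Qed.
HB.instance Definition _ A Th := GRing.isLinear.Build R 'M[R]_(m, k) 'M[R]_(m, k) *:%R
  (newton_lhs A Th) (newton_lhs_linear A Th).

Section Step.
Variables (A Th : 'M[R]_(m + k)).
Hypothesis oTh : orthogonal_mx Th.
Let P := proj_of Th.

Lemma proj_of_tr : P^T = P.
Proof. by rewrite /P proj_ofE conj_by_tr coord_projector_tr. Qed.

Lemma proj_of_idem : P *m P = P.
Proof. by rewrite /P proj_ofE conj_byM // coord_projectorM. Qed.

Lemma offdiag_ur_block Z :
  offdiag P (conj_by Th (ur_block Z)) = conj_by Th (ur_block Z).
Proof.
rewrite /P proj_ofE offdiag_conj // /offdiag coord_projector_complement.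
by rewrite /coord_projector /ur_block !simp.
Qed.

Lemma newton_op_lhs Z :
  newton_op A P (conj_by Th (ur_block Z)) = conj_by Th (ur_block (newton_lhs A Th Z)).
Proof.
rewrite -{1}(conj_byK oTh A) /P proj_ofE newton_op_conj //.
by rewrite -{1}[Th *m A *m Th^T]submxK newton_op_block.
Qed.

Lemma newton_op_eq Z : newton_eq A Th Z ->
  newton_op A P (conj_by Th (ur_block Z)) = - sylvester_op A P ((1%:M - P) *m A *m P)^T.
Proof.
move=> e; rewrite newton_op_lhs [newton_lhs _ _ _]e.
rewrite -[in RHS](conj_byK oTh A) /P proj_ofE conj_by_complement //.
rewrite !conj_byM // conj_by_tr sylvester_op_conj // conj_byN; congr conj_by.
set B := Th *m A *m Th^T; rewrite -[B in RHS]submxK.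
set A11 := ulsubmx B; set A12 := ursubmx B; set A21 := dlsubmx B; set A22 := drsubmx B.
have -> : ((1%:M - coord_projector) *m block_mx A11 A12 A21 A22 *m coord_projector)^T
    = ur_block A21^T.
  by rewrite coord_projector_complement /coord_projector /ur_block !simp.
by rewrite sylvester_op_block /ur_block opp_block_mx !oppr0 opprB.
Qed.

Lemma retraction_mx_conj Z :
  conj_by Th (retraction_mx Z) = 1%:M + conj_by Th (ur_block Z) - (conj_by Th (ur_block Z))^T.
Proof.
rewrite conj_by_tr -(conj_by1 oTh) conj_byN !conj_byD; congr conj_by.
by rewrite scalar_mx_block /ur_block !simp.
Qed.

(** The matrix is [1 + S] with [S] skew-symmetric: a kernel vector satisfies
    [x^T x = - x^T S x = 0]. *)
Lemma retraction_mx_unit Z : retraction_mx Z \in unitmx.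
Proof.
apply: contraT => /nonunit_kernel[x x0 Gx]; case/negP: x0; apply/eqP.
apply: mulTmx_eq0.
pose S := retraction_mx Z - 1%:M.
have ST : S^T = - S.
  have -> : S = block_mx 0 Z (- Z^T) 0.
    by rewrite /S /retraction_mx scalar_mx_block opp_block_mx add_block_mx !oppr0 !subrr !addr0.
  have NT : (- Z^T)^T = - Z by rewrite raddfN /= trmxK.
  by rewrite tr_block_mx NT !trmx0 opp_block_mx !oppr0 opprK.
have e : x^T *m x = - (x^T *m S *m x).
  by rewrite /S mulmxBr mulmx1 mulmxBl -mulmxA Gx mulmx0 sub0r opprK.
have : (x^T *m S *m x)^T = - (x^T *m S *m x).
  by rewrite !trmx_mul trmxK ST mulNmx mulmxN mulmxA.
rewrite e; move: (x^T *m S *m x) => s /matrixP/(_ 0 0); rewrite !mxE; lra.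
Qed.

(** The Gram matrix of the retraction is block diagonal. Since [U] is block upper triangular, its
    upper right block satisfies [U11^T U12 = 0], and [U11] is invertible. *)
Lemma qr_upper_block_diag Z (U : 'M[R]_(m + k)) :
  upper_pos U -> U \in unitmx -> U^T *m U = (retraction_mx Z)^T *m retraction_mx Z ->
  U *m coord_projector = coord_projector *m U.
Proof.
move=> [Utri _] Uu UU.
have U21 : dlsubmx U = 0.
  by apply/matrixP => i j; rewrite !mxE Utri //= (leq_trans (ltn_ord j)) // leq_addr.
move: Uu UU; rewrite -[U]submxK U21 unitmxE det_ublock unitrM => /andP[u1 _].
rewrite /retraction_mx !simp => /eq_block_mx[_ U12 _ _].
have {}U12 : ursubmx U = 0.
  rewrite -unitmxE -unitmx_tr in u1; rewrite -[LHS](mulKmx u1) U12.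
  by rewrite raddfN /= trmxK addrN mulmx0.
by rewrite U12.
Qed.

Lemma step_orthogonal : orthogonal_mx (step A Th).
Proof.
have [oQ _] := qr_QP (retraction_mx_unit (newton_Z A Th)).
rewrite /orthogonal_mx /= /step trmxK trmx_mul trmxK !mulmxA.
by rewrite -(mulmxA Th^T) (orthogonal_mulmxT oQ) mulmx1.
Qed.

(** With [G = Q U] and [U] commuting with the coordinate projector [E], one gets
    [Q E Q^T G = Q E U = G E]: the QR factor can be traded for [G] itself. *)
Lemma step_projector (X := conj_by Th (ur_block (newton_Z A Th))) :
  proj_of (step A Th) *m (1%:M + X - X^T) = (1%:M + X - X^T) *m P.
Proof.
rewrite -retraction_mx_conj /P (proj_ofE Th) conj_byM //.
have Gu := retraction_mx_unit (newton_Z A Th).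
have [oQ [U Uup GE]] := qr_QP Gu.
set G := retraction_mx _ in Gu GE oQ *; set Q := qr_Q G in GE oQ *.
have Uu : U \in unitmx by move: Gu; rewrite GE unitmx_mul => /andP[].
have UU : U^T *m U = G^T *m G.
  by rewrite GE trmx_mul mulmxA -(mulmxA _ Q^T) oQ mulmx1.
have -> : proj_of (step A Th) = conj_by Th (Q *m coord_projector *m Q^T).
  by rewrite /proj_of /step trmxK trmx_mul trmxK /conj_by !mulmxA.
rewrite conj_byM //; congr conj_by.
rewrite GE -!mulmxA (mulmxA Q^T) oQ mul1mx; congr (_ *m _).
by rewrite (qr_upper_block_diag Uup Uu UU).
Qed.

End Step.

(** * One step of the algorithm near the limit *)

Section Convergence.
Variables (A Ps : 'M[R]_(m + k)) (V : {vspace 'cV[R]_(m + k)}).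
Hypotheses (hV : stable_invariant_subspace A V) (hPs : orthogonal_projector_onto V Ps).

Lemma newton_step_spec :
  exists delta K : R, [/\ 0 < delta, 0 <= K &
    forall Th, orthogonal_mx Th -> `|proj_of Th - Ps| <= delta ->
      step_well_defined A Th /\
      `|proj_of (step A Th) - Ps| <= K * `|proj_of Th - Ps| ^+ 2].
Proof.
have [d1 [c [d10 _ c0 coer]]] := newton_op_coercive hV hPs.
have [d2 [K [d20 K0 quad]]] := newton_step_quadratic hV hPs.
exists (Num.min d1 d2), K; split => //; first by rewrite lt_min d10.
move=> Th oTh; rewrite le_min => /andP[h1 h2].
(* Coercivity gives a trivial kernel, hence by finite dimension a unique solution of the linear
   equation. *)
have inj Z : newton_lhs A Th Z = 0 -> Z = 0.
  move=> Z0; apply: ur_block_inj; apply: (conj_by_inj oTh).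
  have b0 : conj_by Th (ur_block 0) = 0 by rewrite /conj_by /ur_block block_mx0 mulmx0 mul0mx.
  have := coer _ _ h1 (offdiag_ur_block oTh Z).
  by rewrite newton_op_lhs // Z0 b0 normr0 mulr0 normr_le0 => /eqP.
have ex : exists! Z, newton_eq A Th Z.
  have [B hB] := injective_linear_onto inj.
  eexists; split; first exact: (hB _).1.
  move=> Z e; rewrite -(hB Z).2; congr (vec_mx (mxvec _ *m B)).
  by rewrite /newton_eq /= in e; symmetry.
have Zeq : newton_eq A Th (newton_Z A Th).
  by case: ex => Z [e _]; apply: (xgetI 0 e).
split; first by split => //; exact: retraction_mx_unit.
apply: quad h2 _ _ (step_projector _ oTh).
- exact: proj_of_tr.
- exact: proj_of_idem.
- exact: offdiag_ur_block.
- exact: newton_op_eq.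
Qed.

End Convergence.

End Blocks.

(** * Local quadratic convergence of the iteration *)

Theorem theorem11 (R : realType) (m k : nat) (hm : (1 <= m)%N)
    (A : 'M[R]_(m + k)) (V : {vspace 'cV[R]_(m + k)}) (Pstar : 'M[R]_(m + k))
    (hdim : \dim V = m) (hV : stable_invariant_subspace A V)
    (hP : orthogonal_projector_onto V Pstar) :
  converges_locally_quadratically A Pstar.
Proof.
have [delta [K [delta0 K0 spec]]] := newton_step_spec hV hP.
(* Within this radius [K x <= 1/2], so the quadratic bound at least halves the error. *)
pose r := Num.min delta (2 * K + 1)^-1.
have K1 : 0 < 2 * K + 1 by rewrite ltr_wpDl // mulr_ge0.
have r0 : 0 < r by rewrite lt_min delta0 invr_gt0.
have le_delta x : x <= r -> x <= delta by rewrite le_min => /andP[].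
have halve x : 0 <= x -> x <= r -> K * x ^+ 2 <= x * 2^-1.
  rewrite le_min => x0 /andP[_ xr].
  have : (2 * K + 1) * x <= 1 by rewrite -ler_pdivlMl ?mulr1.
  nra.
exists (@Gr R (m + k) m `&` [set P | `|P - Pstar| <= r]), K; split.
- by move=> P [].
- apply/nbhs_ballP; exists r => //= P; rewrite mx_norm_ball /ball_ /= distrC => hr GrP.
  by split => //=; exact: ltW.
move=> Th0 [oTh0 _] [_ hr0].
(* Staying in the ball lets the one-step estimate be reapplied; the geometric bound yields
   convergence. *)
have key j : [/\ orthogonal_mx (Theta_seq A Th0 j), `|P_seq A Th0 j - Pstar| <= r &
    `|P_seq A Th0 j - Pstar| <= r * 2^-1 ^+ j].
  elim: j => [|j [oj rj gj]]; first by rewrite expr0 mulr1; split.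
  have [_ quad] := spec _ oj (le_delta _ rj).
  have hj : `|P_seq A Th0 j.+1 - Pstar| <= `|P_seq A Th0 j - Pstar| * 2^-1.
    by apply: le_trans quad (halve _ _ rj).
  split; first exact: step_orthogonal.
    by apply: le_trans hj _; have := normr_ge0 (P_seq A Th0 j - Pstar); lra.
  by apply: le_trans hj _; rewrite exprSr mulrA ler_wpM2r.
split.
- by move=> j; have [oj /le_delta rj _] := key j; have [] := spec _ oj rj.
- apply/cvgrPdist_le => e e0.
  have g0 : r * 2^-1 ^+ j @[j --> \oo] --> (0 : R).
    rewrite -[0](mulr0 r); apply: cvgM; first exact: cvg_cst.
    by apply: cvg_expr; rewrite ger0_norm ?invf_lt1 ?invr_ge0 ?ltr1n.
  near=> j; have [_ _ gj] := key j; rewrite distrC; apply: le_trans gj _.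
  near: j; have /cvgrPdist_le/(_ e e0) := g0; apply: filterS => j.
  by rewrite sub0r normrN; apply: le_trans; exact: ler_norm.
- by move=> j; have [oj /le_delta rj _] := key j; have [] := spec _ oj rj.
Unshelve. all: by end_near.
Qed.
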